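(* Let $F\colon\mathbf C\to\mathbf D$ be left adjoint to $U\colon\mathbf D\to\mathbf C$, with natural isomorphism $\Phi\colon\mathbf D(FX,Y)\cong\mathbf C(X,UY)$, where $\mathbf C,\mathbf D$ have finite coproducts, and let $\mathbb T$ be a guarded iterative monad on $\mathbf D$. Then the monad induced on the composite functor $UTF$ is guarded iterative, when guardedness is defined by: $f\colon X\to UTFY$ is $\sigma$-guarded (for a summand $\sigma$ of $Y$) iff $\Phi^{-1}f\colon FX\to TFY$ is $F\sigma$-guarded; and the unique solutions are given by $f\mapsto\Phi((\Phi^{-1}f)^\dagger)$.
   Context: A summand $\sigma\colon Y'\triangleleft Y$ is a pair $(\sigma_1\colon Y'\to Y,\sigma_2\colon Y''\to Y)$ exhibiting $Y$ as a coproduct; complement $\bar\sigma=(\sigma_2,\sigma_1)$. Since $F$ preserves coproducts, $F\sigma$ is a summand of $FY$ (one may identify $F(Y+Z)=FY+FZ$). For a monad $\mathbb T$ (unit $\eta$, Kleisli lifting $(-)^*$), a guardedness is a relation $f\colon X\to_\sigma TY$ between morphisms $f\colon X\to TY$ and summands $\sigma$ of $Y$ closed under: (trv) $T(\mathrm{inl})\circ f\colon X\to_{\mathrm{inr}}T(Y+Z)$ for any $f\colon X\to TY$; (par) $f\colon X\to_\sigma TZ$, $g\colon Y\to_\sigma TZ$ imply $[f,g]\colon X+Y\to_\sigma TZ$; (cmp) $f\colon X\to_{\mathrm{inr}}T(Y+Z)$, $g\colon Y\to_\sigma TV$, $h\colon Z\to TV$ imply $[g,h]^*\circ f\colon X\to_\sigma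 TV$. It is guarded iterative if every $f\colon X\to_{\mathrm{inr}}T(Y+X)$ has a unique solution $f^\dagger\colon X\to TY$, i.e. $f^\dagger=[\eta,f^\dagger]^*\circ f$. The induced monad on $UTF$ has unit $U\eta_F\circ(\text{unit of }F\dashv U)$ and multiplication $U\mu^{\mathbb T}_F\circ UT(\text{counit})_{TF}$. *)

(* Defs.v *)
From Stdlib Require Import IndefiniteDescription ProofIrrelevance.

Set Implicit Arguments.
Unset Strict Implicit.
Unset Printing Implicit Defensive.

Declare Scope cat_scope.
Open Scope cat_scope.

Reserved Notation "A ~> B" (at level 70, no associativity).
Reserved Notation "g ∘ f" (at level 40, left associativity).

Record category := Category {
  obj :> Type;
  hom : obj -> obj -> Type where "A ~> B" := (hom A B);
  idm : forall A, A ~> A;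
  comp : forall A B C, B ~> C -> A ~> B -> A ~> C
    where "g ∘ f" := (comp g f);
  comp_id_l : forall A B (f : A ~> B), idm B ∘ f = f;
  comp_id_r : forall A B (f : A ~> B), f ∘ idm A = f;
  comp_assoc : forall A B C D (h : C ~> D) (g : B ~> C) (f : A ~> B),
    h ∘ (g ∘ f) = h ∘ g ∘ f }.

Arguments idm {c} A.
Notation "A ~> B" := (hom A B) : cat_scope.
Notation "g ∘ f" := (comp g f) : cat_scope.

Record functor (C D : category) := Functor {
  fobj :> C -> D;
  fmap : forall A B : C, A ~> B -> fobj A ~> fobj B;
  fmap_id : forall A : C, fmap (idm A) = idm (fobj A);
  fmap_comp : forall (A B E : C) (g : B ~> E) (f : A ~> B),
    fmap (g ∘ f) = fmap g ∘ fmap f }.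

Arguments fmap {C D} _ {A B} _.

Lemma compose_functor_id (C D E : category) (G : functor D E)
  (F : functor C D) (A : C) : fmap G (fmap F (idm A)) = idm (G (F A)).
Proof. now rewrite !fmap_id. Qed.

Lemma compose_functor_comp (C D E : category) (G : functor D E)
  (F : functor C D) (A B B' : C) (g : B ~> B') (f : A ~> B) :
  fmap G (fmap F (g ∘ f)) = fmap G (fmap F g) ∘ fmap G (fmap F f).
Proof. now rewrite !fmap_comp. Qed.

Definition compose_functor (C D E : category) (G : functor D E)
    (F : functor C D) : functor C E :=
  {| fobj := fun A => G (F A);
     fmap := fun A B f => fmap G (fmap F f);
     fmap_id := compose_functor_id G F;
     fmap_comp := compose_functor_comp G F |}.

Section Coproducts.
Variable C : category.

Definition is_initial (I : C) : Prop :=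
  forall A : C, exists! h : I ~> A, True.

Definition is_coproduct (A B W : C) (i : A ~> W) (j : B ~> W) : Prop :=
  forall (V : C) (f : A ~> V) (g : B ~> V),
    exists! h : W ~> V, h ∘ i = f /\ h ∘ j = g.

Lemma is_coproduct_swap (A B W : C) (i : A ~> W) (j : B ~> W) :
  is_coproduct i j -> is_coproduct j i.
Proof.
intros H V f g; destruct (H V g f) as [h [[h1 h2] hu]].
exists h; split; [now split|]; intros k [k1 k2]; now apply hu.
Qed.

(* An object together with injections making it "A + B".  Coproducts are only
   determined up to isomorphism, and no representative is singled out: "A + B"
   below always ranges over all [coproduct A B]. *)
Record coproduct (A B : C) := Coproduct {
  cop_obj :> C;
  inl : A ~> cop_obj;
  inr : B ~> cop_obj;
  cop_prop : is_coproduct inl inr }.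

Arguments cop_prop {A B} c.

Definition has_finite_coproducts : Prop :=
  (exists I : C, is_initial I) /\ (forall A B : C, inhabited (coproduct A B)).

Definition copair (A B : C) (S : coproduct A B) (V : C) (f : A ~> V)
    (g : B ~> V) : S ~> V :=
  proj1_sig (constructive_indefinite_description _ (cop_prop S V f g)).

Lemma copair_inl (A B : C) (S : coproduct A B) (V : C) (f : A ~> V)
  (g : B ~> V) : copair S f g ∘ inl S = f.
Proof.
unfold copair.
now destruct (constructive_indefinite_description _ _) as [h [[? ?] ?]].
Qed.

Lemma copair_inr (A B : C) (S : coproduct A B) (V : C) (f : A ~> V)
  (g : B ~> V) : copair S f g ∘ inr S = g.
Proof.
unfold copair.
now destruct (constructive_indefinite_description _ _) as [h [[? ?] ?]].
Qed.

Lemma copair_unique (A B : C) (S : coproduct A B) (V : C) (f : A ~> V)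
  (g : B ~> V) (h : S ~> V) :
  h ∘ inl S = f -> h ∘ inr S = g -> h = copair S f g.
Proof.
intros h1 h2; unfold copair.
destruct (constructive_indefinite_description _ _) as [k [? hu]]; simpl.
symmetry; apply hu; now split.
Qed.

Record summand (Y : C) := Summand {
  sm_part : C;
  sm_compl : C;
  sm_inj1 : sm_part ~> Y;
  sm_inj2 : sm_compl ~> Y;
  sm_prop : is_coproduct sm_inj1 sm_inj2 }.

Definition summand_inr (A B : C) (S : coproduct A B) : summand S :=
  Summand (is_coproduct_swap (cop_prop S)).

End Coproducts.

Arguments inl {C A B} c.
Arguments inr {C A B} c.
Arguments cop_prop {C A B} c.
Arguments sm_prop {C Y} s.

Record monad (D : category) := Monad {
  mfunctor :> functor D D;
  eta : forall A : D, A ~> mfunctor A;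
  mu : forall A : D, mfunctor (mfunctor A) ~> mfunctor A;
  eta_nat : forall (A B : D) (f : A ~> B),
    eta B ∘ f = fmap mfunctor f ∘ eta A;
  mu_nat : forall (A B : D) (f : A ~> B),
    mu B ∘ fmap mfunctor (fmap mfunctor f) = fmap mfunctor f ∘ mu A;
  mu_eta_l : forall A : D, mu A ∘ eta (mfunctor A) = idm (mfunctor A);
  mu_eta_r : forall A : D, mu A ∘ fmap mfunctor (eta A) = idm (mfunctor A);
  mu_assoc : forall A : D,
    mu A ∘ mu (mfunctor A) = mu A ∘ fmap mfunctor (mu A) }.

Arguments eta {D} m A.
Arguments mu {D} m A.

Definition kleisli (D : category) (T : monad D) (A B : D) (f : A ~> T B) :
  T A ~> T B := mu T B ∘ fmap T f.

Definition guard_rel (D : category) (T : monad D) :=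
  forall X Y : D, X ~> T Y -> summand Y -> Prop.

Record is_guardedness (D : category) (T : monad D) (R : guard_rel T) : Prop := {
  guard_trv : forall (X Y Z : D) (S : coproduct Y Z) (f : X ~> T Y),
    R X S (fmap T (inl S) ∘ f) (summand_inr S);
  guard_par : forall (X Y Z : D) (S : coproduct X Y) (s : summand Z)
    (f : X ~> T Z) (g : Y ~> T Z),
    R X Z f s -> R Y Z g s -> R S Z (copair S f g) s;
  guard_cmp : forall (X Y Z V : D) (S : coproduct Y Z) (s : summand V)
    (f : X ~> T S) (g : Y ~> T V) (h : Z ~> T V),
    R X S f (summand_inr S) -> R Y V g s ->
    R X V (kleisli (copair S g h) ∘ f) s }.

Definition is_solution (D : category) (T : monad D) (X Y : D)
    (S : coproduct Y X) (f : X ~> T S) (e : X ~> T Y) : Prop :=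
  e = kleisli (copair S (eta T Y) e) ∘ f.

Arguments is_solution {D} T {X Y} S f e.

Record guarded_iterative (D : category) (T : monad D) (R : guard_rel T) :
    Prop := {
  gi_guardedness : is_guardedness R;
  gi_solution : forall (X Y : D) (S : coproduct Y X) (f : X ~> T S),
    R X S f (summand_inr S) -> exists! e : X ~> T Y, is_solution T S f e }.

Arguments guarded_iterative {D} T R.

Definition dagger (D : category) (T : monad D) (R : guard_rel T)
    (H : guarded_iterative T R) (X Y : D) (S : coproduct Y X) (f : X ~> T S)
    (Hf : R X S f (summand_inr S)) : X ~> T Y :=
  proj1_sig (constructive_indefinite_description _ (gi_solution H Hf)).

Arguments dagger {D T R} H {X Y} S f Hf.

Record adjunction (C D : category) (F : functor C D) (U : functor D C) :=
  Adjunction {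
  Phi : forall (X : C) (Y : D), F X ~> Y -> X ~> U Y;
  PhiV : forall (X : C) (Y : D), X ~> U Y -> F X ~> Y;
  PhiK : forall (X : C) (Y : D) (f : F X ~> Y), PhiV (Phi f) = f;
  PhiVK : forall (X : C) (Y : D) (f : X ~> U Y), Phi (PhiV f) = f;
  Phi_nat_l : forall (X X' : C) (Y : D) (f : F X ~> Y) (k : X' ~> X),
    Phi (f ∘ fmap F k) = Phi f ∘ k;
  Phi_nat_r : forall (X : C) (Y Y' : D) (h : Y ~> Y') (f : F X ~> Y),
    Phi (h ∘ f) = fmap U h ∘ Phi f }.

Arguments Phi {C D F U} a {X Y}.
Arguments PhiV {C D F U} a {X Y}.

Section InducedMonad.
Variables (C D : category) (F : functor C D) (U : functor D C).
Variable adj : adjunction F U.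

Definition adj_unit (X : C) : X ~> U (F X) := Phi adj (idm (F X)).
Definition adj_counit (Y : D) : F (U Y) ~> Y := PhiV adj (idm (U Y)).

Lemma PhiV_nat_l (X X' : C) (Y : D) (f : X ~> U Y) (k : X' ~> X) :
  PhiV adj (f ∘ k) = PhiV adj f ∘ fmap F k.
Proof. now rewrite <- (PhiK adj (_ ∘ fmap F k)), Phi_nat_l, PhiVK. Qed.

Lemma PhiV_nat_r (X : C) (Y Y' : D) (h : Y ~> Y') (f : X ~> U Y) :
  PhiV adj (fmap U h ∘ f) = h ∘ PhiV adj f.
Proof. now rewrite <- (PhiK adj (h ∘ _)), Phi_nat_r, PhiVK. Qed.

Lemma adj_unit_nat (X Y : C) (f : X ~> Y) :
  adj_unit Y ∘ f = fmap U (fmap F f) ∘ adj_unit X.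
Proof.
unfold adj_unit.
now rewrite <- Phi_nat_l, <- Phi_nat_r, comp_id_l, comp_id_r.
Qed.

Lemma adj_counit_nat (X Y : D) (f : X ~> Y) :
  adj_counit Y ∘ fmap F (fmap U f) = f ∘ adj_counit X.
Proof.
unfold adj_counit.
now rewrite <- PhiV_nat_l, <- PhiV_nat_r, comp_id_l, comp_id_r.
Qed.

Lemma adj_triangle_l (X : C) :
  adj_counit (F X) ∘ fmap F (adj_unit X) = idm (F X).
Proof.
unfold adj_counit, adj_unit.
now rewrite <- PhiV_nat_l, comp_id_l, PhiK.
Qed.

Lemma adj_triangle_r (Y : D) :
  fmap U (adj_counit Y) ∘ adj_unit (U Y) = idm (U Y).
Proof.
unfold adj_counit, adj_unit.
now rewrite <- Phi_nat_r, comp_id_r, PhiVK.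
Qed.

Lemma is_coproduct_fmap (A B W : C) (i : A ~> W) (j : B ~> W) :
  is_coproduct i j -> is_coproduct (fmap F i) (fmap F j).
Proof.
intros H V f g.
destruct (H (U V) (Phi adj f) (Phi adj g)) as [h [[h1 h2] hu]].
exists (PhiV adj h); split.
- split; rewrite <- PhiV_nat_l; [rewrite h1|rewrite h2]; apply PhiK.
- intros k [<- <-]; rewrite (hu (Phi adj k)); [apply PhiK|].
  now rewrite !Phi_nat_l.
Qed.

Definition coproduct_map (A B : C) (S : coproduct A B) :
  coproduct (F A) (F B) := Coproduct (is_coproduct_fmap (cop_prop S)).

Definition summand_map (Y : C) (s : summand Y) : summand (F Y) :=
  Summand (is_coproduct_fmap (sm_prop s)).

Lemma summand_map_inr (A B : C) (S : coproduct A B) :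
  summand_map (summand_inr S) = summand_inr (coproduct_map S).
Proof.
unfold summand_map, summand_inr; simpl.
now f_equal; apply proof_irrelevance.
Qed.

Variable T : monad D.

Definition induced_functor : functor C C :=
  compose_functor U (compose_functor T F).

Definition induced_eta (X : C) : X ~> induced_functor X :=
  fmap U (eta T (F X)) ∘ adj_unit X.

Definition induced_mu (X : C) :
    induced_functor (induced_functor X) ~> induced_functor X :=
  fmap U (mu T (F X)) ∘ fmap U (fmap T (adj_counit (T (F X)))).

Lemma induced_eta_nat (X Y : C) (f : X ~> Y) :
  induced_eta Y ∘ f = fmap induced_functor f ∘ induced_eta X.
Proof.
unfold induced_eta; simpl.
rewrite <- comp_assoc, adj_unit_nat, !comp_assoc, <- !fmap_comp.
now rewrite eta_nat.
Qed.

Lemma induced_mu_nat (X Y : C) (f : X ~> Y) :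
  induced_mu Y ∘ fmap induced_functor (fmap induced_functor f)
  = fmap induced_functor f ∘ induced_mu X.
Proof.
unfold induced_mu; simpl.
rewrite <- !fmap_comp; f_equal.
rewrite <- comp_assoc, <- fmap_comp, adj_counit_nat, fmap_comp.
now rewrite !comp_assoc, mu_nat.
Qed.

Lemma induced_mu_eta_l (X : C) :
  induced_mu X ∘ induced_eta (induced_functor X) = idm (induced_functor X).
Proof.
unfold induced_mu, induced_eta; simpl.
rewrite comp_assoc, <- !fmap_comp.
rewrite <- (comp_assoc (mu T (F X))), <- eta_nat, comp_assoc, mu_eta_l.
now rewrite comp_id_l, adj_triangle_r.
Qed.

Lemma induced_mu_eta_r (X : C) :
  induced_mu X ∘ fmap induced_functor (induced_eta X)
  = idm (induced_functor X).
Proof.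
unfold induced_mu, induced_eta; simpl.
rewrite <- !fmap_comp, <- (comp_assoc (mu T (F X))), <- fmap_comp.
rewrite (fmap_comp F), (comp_assoc (adj_counit _)), adj_counit_nat.
rewrite <- (comp_assoc (eta T (F X))), adj_triangle_l, comp_id_r, mu_eta_r.
apply fmap_id.
Qed.

Lemma induced_mu_assoc (X : C) :
  induced_mu X ∘ induced_mu (induced_functor X)
  = induced_mu X ∘ fmap induced_functor (induced_mu X).
Proof.
unfold induced_mu; simpl.
rewrite <- !fmap_comp; f_equal.
rewrite <- !(comp_assoc (mu T (F X))), <- fmap_comp, adj_counit_nat.
rewrite (comp_assoc (fmap T _)), <- mu_nat.
rewrite !fmap_comp, !comp_assoc, mu_assoc.
rewrite <- !comp_assoc.
reflexivity.
Qed.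

Definition induced_monad : monad C :=
  {| mfunctor := induced_functor;
     eta := induced_eta;
     mu := induced_mu;
     eta_nat := induced_eta_nat;
     mu_nat := induced_mu_nat;
     mu_eta_l := induced_mu_eta_l;
     mu_eta_r := induced_mu_eta_r;
     mu_assoc := induced_mu_assoc |}.

Definition induced_guard (R : guard_rel T) : guard_rel induced_monad :=
  fun (X Y : C) (f : X ~> U (T (F Y))) (s : summand Y) =>
    R (F X) (F Y) (PhiV adj f) (summand_map s).

Arguments induced_guard R X Y f s : clear implicits.

Lemma induced_guard_inr (R : guard_rel T) (X Y Z : C) (S : coproduct Y Z)
  (f : X ~> induced_monad S) :
  induced_guard R X S f (summand_inr S) ->
  R (F X) (coproduct_map S) (PhiV adj f) (summand_inr (coproduct_map S)).
Proof. now rewrite <- summand_map_inr. Qed.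

End InducedMonad.

Arguments coproduct_map {C D F U} adj {A B} S.
Arguments summand_map {C D F U} adj {Y} s.
Arguments induced_monad {C D F U} adj T.
Arguments induced_guard {C D F U} adj {T} R X Y f s.
Arguments induced_guard_inr {C D F U} adj {T R X Y Z S f}.

(* Main.v *)
(** Transposition along the adjunction turns Kleisli composition, unit and
    copairing of the induced monad into those of the original monad on
    objects in the image of [F].  Hence the guardedness axioms transfer, and
    [e] solves [f] exactly when the transpose of [e] solves that of [f]. *)
Require Import Defs.
From Stdlib Require Import IndefiniteDescription.

Set Implicit Arguments.
Unset Strict Implicit.
Unset Printing Implicit Defensive.

Lemma dagger_is_solution (D : category) (T : monad D) (R : guard_rel T)
  (H : guarded_iterative T R) (X Y : D) (S : coproduct Y X) (f : X ~> T S)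
  (Hf : R X S f (summand_inr S)) : is_solution T S f (dagger H S f Hf).
Proof.
unfold dagger.
now destruct (constructive_indefinite_description _ _) as [e [? ?]].
Qed.

(** [dagger] is extracted by choice, so it can be identified with another solution only through
    uniqueness. *)
Lemma solution_unique (D : category) (T : monad D) (R : guard_rel T)
  (H : guarded_iterative T R) (X Y : D) (S : coproduct Y X) (f : X ~> T S)
  (Hf : R X S f (summand_inr S)) (e e' : X ~> T Y) :
  is_solution T S f e -> is_solution T S f e' -> e = e'.
Proof.
intros He He'; destruct (gi_solution H Hf) as [d [_ Hd]].
now rewrite <- (Hd e He), <- (Hd e' He').
Qed.

Section Transposition.
Variables (C D : category) (F : functor C D) (U : functor D C).
Variable adj : adjunction F U.

Lemma PhiV_counit (X : C) (Y : D) (f : X ~> U Y) :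
  adj_counit adj Y ∘ fmap F f = PhiV adj f.
Proof. unfold adj_counit; now rewrite <- PhiV_nat_l, comp_id_l. Qed.

(** As a left adjoint, [F] preserves coproducts, so it suffices to compare both sides on the
    injections [fmap F (inl S)] and [fmap F (inr S)]. *)
Lemma PhiV_copair (A B : C) (S : coproduct A B) (V : D) (g : A ~> U V)
  (h : B ~> U V) :
  PhiV adj (copair S g h)
  = copair (coproduct_map adj S) (PhiV adj g) (PhiV adj h).
Proof.
apply (copair_unique (S := coproduct_map adj S)); simpl; rewrite <- PhiV_nat_l.
- now rewrite copair_inl.
- now rewrite copair_inr.
Qed.

Variable T : monad D.
Local Notation UTF := (induced_monad adj T).

Lemma PhiV_induced_eta (X : C) : PhiV adj (Y := T (F X)) (eta UTF X) = eta T (F X).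
Proof.
simpl; unfold induced_eta, adj_unit.
now rewrite PhiV_nat_r, PhiK, comp_id_r.
Qed.

(** The counit inside [induced_mu] turns [fmap F g] into [PhiV adj g]; naturality in the codomain
    strips the outer [U]. *)
Lemma PhiV_kleisli (X A B : C) (g : A ~> UTF B) (f : X ~> UTF A) :
  PhiV adj (Y := T (F B)) (kleisli g ∘ f)
  = kleisli (T := T) (PhiV adj g : F A ~> T (F B)) ∘ PhiV adj f.
Proof.
unfold kleisli; simpl; unfold induced_mu.
rewrite <- !fmap_comp, PhiV_nat_r; f_equal.
now rewrite <- comp_assoc, <- fmap_comp, PhiV_counit.
Qed.

Lemma PhiV_kleisli_copair (X A B V : C) (S : coproduct A B) (g : A ~> UTF V)
  (h : B ~> UTF V) (f : X ~> UTF S) :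
  PhiV adj (Y := T (F V)) (kleisli (copair S g h) ∘ f)
  = kleisli (T := T)
      (copair (coproduct_map adj S) (PhiV adj g : F A ~> T (F V)) (PhiV adj h))
    ∘ PhiV adj f.
Proof. rewrite PhiV_kleisli; simpl; now rewrite PhiV_copair. Qed.

Lemma is_solution_PhiV (X Y : C) (S : coproduct Y X) (f : X ~> UTF S)
  (e : X ~> UTF Y) :
  is_solution UTF S f e <->
  is_solution T (coproduct_map adj S) (PhiV adj f) (PhiV adj e).
Proof.
unfold is_solution; rewrite <- PhiV_induced_eta, <- PhiV_kleisli_copair.
split; intros H.
(* The equation is recursive in [e], so only the occurrence on its left side is unfolded. *)
- now rewrite H at 1.
(* The converse rests on the injectivity of [PhiV]. *)
- now rewrite <- (PhiVK adj e), H, PhiVK at 1.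
Qed.

Variable R : guard_rel T.

Lemma induced_is_guardedness :
  is_guardedness R -> is_guardedness (induced_guard adj R).
Proof.
intros HR; split.
- intros X Y Z S f; unfold induced_guard.
  (* Transposition leaves [fmap T (fmap F (inl S))] in front, and [fmap F (inl S)] is the left
     injection of [coproduct_map adj S]. *)
  simpl; rewrite PhiV_nat_r, summand_map_inr.
  exact (guard_trv HR (coproduct_map adj S) (PhiV adj f)).
- intros X Y Z S s f g Hf Hg; unfold induced_guard in *.
  simpl; rewrite PhiV_copair.
  exact (guard_par HR (coproduct_map adj S) Hf Hg).
- intros X Y Z V S s f g h Hf Hg.
  unfold induced_guard; rewrite PhiV_kleisli_copair.
  exact (guard_cmp HR _ (induced_guard_inr adj Hf) Hg).
Qed.

Hypothesis HT : guarded_iterative T R.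

Lemma Phi_dagger_is_solution (X Y : C) (S : coproduct Y X) (f : X ~> UTF S)
  (Hf : induced_guard adj R X S f (summand_inr S)) :
  is_solution UTF S f
    (Phi adj (dagger HT (coproduct_map adj S) (PhiV adj f)
                (induced_guard_inr adj Hf))).
Proof. apply is_solution_PhiV; rewrite PhiK; apply dagger_is_solution. Qed.

Lemma induced_guarded_iterative : guarded_iterative UTF (induced_guard adj R).
Proof.
split; [exact (induced_is_guardedness (gi_guardedness HT))|].
intros X Y S f Hf; eexists; split; [exact (Phi_dagger_is_solution Hf)|].
(* Every candidate is the [Phi] of its own transpose, which reduces uniqueness to that of solutions
   for [T]. *)
intros e He; rewrite <- (PhiVK adj e); f_equal.
apply (solution_unique HT (induced_guard_inr adj Hf)).
- apply dagger_is_solution.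
- now apply is_solution_PhiV.
Qed.

End Transposition.

Theorem theorem6p1 (C D : category)
  (HC : has_finite_coproducts C) (HD : has_finite_coproducts D)
  (F : functor C D) (U : functor D C) (adj : adjunction F U)
  (T : monad D) (R : guard_rel T) (HT : guarded_iterative T R) :
  exists HU : guarded_iterative (induced_monad adj T) (induced_guard adj R),
    forall (X Y : C) (S : coproduct Y X) (f : X ~> induced_monad adj T S)
      (Hf : induced_guard adj R X S f (summand_inr S)),
      dagger HU S f Hf =
        Phi adj (dagger HT (coproduct_map adj S) (PhiV adj f)
                   (induced_guard_inr adj Hf)).
Proof.
exists (induced_guarded_iterative adj HT); intros X Y S f Hf.
(* The chosen solution and the transposed one agree because both solve [f]. *)
apply (solution_unique (induced_guarded_iterative adj HT) Hf).
- apply dagger_is_solution.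
- apply Phi_dagger_is_solution.
Qed.
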